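(* Let $\{Z_n\}_{n\in\mathbb{N}}$ be a sequence of diagonal matrices $Z_n=\mathrm{diag}(z_1^{(n)},\ldots,z_n^{(n)})$ with $z_j^{(n)}\geq 1$ having bounded squeezing of degree $\zeta$ with $0\leq\zeta<1$, and assume that the average energy $\lambda(n)=\frac{1}{2n}\sum_{j=1}^n (z_j^{(n)}+1/z_j^{(n)})$ is uniformly bounded in $n$. Let $\{k_n\}_{n\in\mathbb{N}}$ be a sequence of subsystem sizes bounded of degree $\kappa$ with $0\leq\kappa<1$, and write $k=k_n$. Then $$\mathbb{E}\big[(J_kM_{n,k}(U))^2\big]=\big(-\lambda(n)^2+O(n^{\kappa+\zeta-1})\big)I_{2k},$$ where the expectation is over $U$ drawn from the Haar measure on the unitary group $U(n)$.
   Context: For $m\in\mathbb{N}$ let $J_m=\begin{pmatrix}0_m&-I_m\\ I_m&0_m\end{pmatrix}$. For $U\in U(n)$ let $\eta(U)=\begin{pmatrix}\mathrm{Re}(U)&\mathrm{Im}(U)\\ -\mathrm{Im}(U)&\mathrm{Re}(U)\end{pmatrix}\in\mathbb{R}^{2n\times 2n}$ (an orthogonal symplectic matrix). Set $\hat Z_n=Z_n\oplus Z_n^{-1}$ and $M_n(U)=\eta(U)\hat Z_n\eta(U)^T$. For $1\leq k\leq n$, $M_{n,k}(U)$ denotes the $2k\times 2k$ submatrix of $M_n(U)$ with rows and columns indexed by $\{1,\ldots,k\}\cup\{n+1,\ldots,n+k\}$ (in this order); it is the covariance matrix of the reduced state on the first $k$ modes of the pure Gaussian state with covariance matrix $M_n(U)$.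 A sequence $\{Z_n\}$ has bounded squeezing of degree $\zeta\ge 0$ if there is $C>0$ with $\|Z_n\|_\infty\leq Cn^\zeta$ for all large enough $n$. A sequence $\{k_n\}$ with $k_n\in\{1,\ldots,n\}$ is bounded of degree $\kappa\geq 0$ if there is $K>0$ with $k_n\leq Kn^\kappa$ for all large enough $n$. *)

(* Defs.v *)
From HB Require Import structures.
From mathcomp Require Import all_boot all_order all_algebra.
From mathcomp Require Import all_classical all_reals.
From mathcomp Require Import topology matrix_topology normedtype matrix_normedtype sequences exp measure lebesgue_measure
  lebesgue_integral probability.
From mathcomp Require Import complex.
Import numFieldNormedType.Exports.
Set Implicit Arguments. Unset Strict Implicit. Unset Printing Implicit Defensive.
Import Order.TTheory GRing.Theory Num.Theory.
Local Open Scope ring_scope.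

Section Defs.
Variable R : realType.

Definition conjM n (U : 'M[R[i]]_n) : 'M[R[i]]_n := map_mx (@conjc R) U.

Definition unitary n (U : 'M[R[i]]_n) : Prop := U *m (conjM U)^T = 1%:M.

Definition reM n (U : 'M[R[i]]_n) : 'M[R]_n := map_mx (@complex.Re R) U.
Definition imM n (U : 'M[R[i]]_n) : 'M[R]_n := map_mx (@complex.Im R) U.

Definition eta n (U : 'M[R[i]]_n) : 'M[R]_(n + n) :=
  block_mx (reM U) (imM U) (- imM U) (reM U).

Definition Jmx m : 'M[R]_(m + m) := block_mx 0 (- 1%:M) 1%:M 0.

Definition Zhat n (z : 'I_n -> R) : 'M[R]_(n + n) :=
  diag_mx (\row_(i < n + n) match fintype.split i with inl a => z a | inr b => (z b)^-1 end).

Definition Mn n (z : 'I_n -> R) (U : 'M[R[i]]_n) : 'M[R]_(n + n) :=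
  eta U *m Zhat z *m (eta U)^T.

Definition sel k n (hk : (k <= n)%N) (i : 'I_(k + k)) : 'I_(n + n) :=
  match fintype.split i with
  | inl a => lshift n (widen_ord hk a)
  | inr b => rshift n (widen_ord hk b)
  end.

Definition Mnk n k (hk : (k <= n)%N) (z : 'I_n -> R) (U : 'M[R[i]]_n) : 'M[R]_(k + k) :=
  mxsub (sel hk) (sel hk) (Mn z U).

Definition opnorm_diag n (z : 'I_n -> R) : R := \big[Num.max/0]_(j < n) `|z j|.

Definition avg_energy n (z : 'I_n -> R) : R :=
  (2 * n%:R)^-1 * \sum_(j < n) (z j + (z j)^-1).

Definition Emx d (T : measurableType d) (P : probability T R) m p
  (X : T -> 'M[R]_(m, p)) : 'M[R]_(m, p) :=
  \matrix_(i, j) fine (\int[P]_w (X w i j)%:E)%E.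

(** U : T -> U(n) is a Haar-distributed random unitary matrix on the probability
    space (T, P): it takes values in U(n), its entries are measurable, and its law
    is invariant under left multiplication by any fixed unitary V (the law being
    tested against all continuous functions of (Re U, Im U)). By uniqueness of the
    left-invariant probability measure on the compact group U(n), this determines
    the Haar measure. *)
Definition haar_unitary n d (T : measurableType d) (P : probability T R)
  (U : T -> 'M[R[i]]_n) : Prop :=
  [/\ forall w, unitary (U w),
      forall i j, measurable_fun setT (fun w => complex.Re (U w i j)) /\
                  measurable_fun setT (fun w => complex.Im (U w i j)) &
      forall V : 'M[R[i]]_n, unitary V ->
      forall f : 'M[R]_n * 'M[R]_n -> R, continuous f ->
        (\int[P]_w (f (reM (V *m U w), imM (V *m U w)))%:E =
         \int[P]_w (f (reM (U w), imM (U w)))%:E)%E].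

End Defs.

(* Main.v *)
(** Write [z± = (z ± 1/z)/2], [H = U Z+ U^*] and [W = U Z- U^T], where [H] is
    Hermitian and [W] complex symmetric. In terms of the compressions of [H] and
    [W] to the first [k] coordinates, [(J_k M_{n,k})^2] is the real form of the
    semilinear map
      [- (H_k^2 - W_k conj(W_k)) - (H_k W_k - W_k conj(H_k)) o conj].
    Left invariance of the law of [U] under phases, signs, permutations and one
    rational reflection suffices to determine the second moments needed: mixed
    [H]-[W] moments and off-diagonal entries vanish, and
      [E|H_ab|^2 = x + [a = b] w],  [E H_aa H_bb = w + [a = b] x],
      [E|W_ab|^2 = (1 + [a = b]) u].
    Since [tr H = tr Z+], [tr H^2 = tr Z+^2] and [tr W W^* = tr Z-^2] are not
    random, [x], [w] and [u] solve a linear system, and the expectation is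
    exactly [- (w + k x - (k + 1) u)] times the identity. Its distance to
    [- lambda^2] is estimated through [tr Z+^2 <= ||Z|| tr Z+]. *)
Require Import Defs.
From HB Require Import structures.
From mathcomp Require Import all_boot all_order all_algebra.
From mathcomp Require Import all_classical all_reals.
From mathcomp Require Import topology matrix_topology normedtype matrix_normedtype sequences exp measure lebesgue_measure
  lebesgue_integral probability.
From mathcomp Require Import complex.
From mathcomp Require Import fingroup perm measurable_realfun ring lra.
Import numFieldNormedType.Exports.
Import Order.TTheory GRing.Theory Num.Theory.
Local Open Scope ring_scope.

(** * Polynomials in the entries of a matrix and their conjugates *)

Section StarPolynomials.
Set Implicit Arguments.
Unset Strict Implicit.
Variables (R : realType) (n : nat).
Local Notation C := R[i].
Implicit Types F G : 'M[C]_n -> C.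

(** The observables to be averaged. The class contains the quadratic expressions in [H] and [W], and
    its members are continuous, hence admissible in the invariance hypothesis, and bounded on U(n),
    hence integrable. *)
Inductive starpoly : ('M[C]_n -> C) -> Prop :=
| sp_const c : starpoly (fun=> c)
| sp_entry i j : starpoly (fun X => X i j)
| sp_conj F : starpoly F -> starpoly (fun X => (F X)^*%C)
| sp_add F G : starpoly F -> starpoly G -> starpoly (fun X => F X + G X)
| sp_mul F G : starpoly F -> starpoly G -> starpoly (fun X => F X * G X).

Lemma sp_sum (I : Type) (r : seq I) (F : I -> 'M[C]_n -> C) :
  (forall i, starpoly (F i)) -> starpoly (fun X => \sum_(i <- r) F i X).
Proof.
move=> hF; elim: r => [|i r ih].
  rewrite (_ : (fun _ => _) = fun=> 0); first exact: sp_const.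
  by apply/funext => X; rewrite big_nil.
rewrite (_ : (fun _ => _) = fun X => F i X + \sum_(i <- r) F i X).
  exact: sp_add.
by apply/funext => X; rewrite big_cons.
Qed.

Lemma sp_opp F : starpoly F -> starpoly (fun X => - F X).
Proof.
move=> hF; rewrite (_ : (fun _ => _) = fun X => -1 * F X).
  by apply: sp_mul => //; exact: sp_const.
by apply/funext => X; rewrite mulN1r.
Qed.

(** Inverse of X |-> (Re X, Im X); the Haar hypothesis tests functions of such real pairs. *)
Definition complexify (p : 'M[R]_n * 'M[R]_n) : 'M[C]_n :=
  \matrix_(i, j) (p.1 i j +i* p.2 i j)%C.

Lemma complexifyK (X : 'M[C]_n) : complexify (reM X, imM X) = X.
Proof. by apply/matrixP => i j; rewrite !mxE; case: (X i j). Qed.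

Lemma ReM (x y : C) :
  complex.Re (x * y) = complex.Re x * complex.Re y - complex.Im x * complex.Im y.
Proof. by case: x => a b; case: y. Qed.

Lemma ImM (x y : C) :
  complex.Im (x * y) = complex.Re x * complex.Im y + complex.Im x * complex.Re y.
Proof. by case: x => a b; case: y. Qed.

Lemma Re_conjc (x : C) : complex.Re x^*%C = complex.Re x.
Proof. by case: x. Qed.

Lemma Im_conjc (x : C) : complex.Im x^*%C = - complex.Im x.
Proof. by case: x. Qed.

Lemma starpoly_continuous F : starpoly F ->
  continuous (fun p => complex.Re (F (complexify p))) /\
  continuous (fun p => complex.Im (F (complexify p))).
Proof.
have cD (X : topologicalType) (f g : X -> R) : continuous f -> continuous g ->
    continuous (fun x => f x + g x).
  by move=> cf cg x; exact: (continuousD (cf x) (cg x)).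
have cM (X : topologicalType) (f g : X -> R) : continuous f -> continuous g ->
    continuous (fun x => f x * g x).
  by move=> cf cg x; exact: (continuousM (cf x) (cg x)).
elim=> {F} [c|i j|F _ [cR cI]|F G _ [cRF cIF] _ [cRG cIG]|
            F G _ [cRF cIF] _ [cRG cIG]].
- by split; apply: cst_continuous.
- split.
  + under [X in continuous X]funext do rewrite mxE /=.
    move=> p; apply: (@continuous_comp _ _ _ fst (fun M : 'M[R]_n => M i j)).
      exact: cvg_fst.
    exact: coord_continuous.
  + under [X in continuous X]funext do rewrite mxE /=.
    move=> p; apply: (@continuous_comp _ _ _ snd (fun M : 'M[R]_n => M i j)).
      exact: cvg_snd.
    exact: coord_continuous.
- split.
  + by under [X in continuous X]funext do rewrite Re_conjc.
  + under [X in continuous X]funext do rewrite Im_conjc.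
    by move=> p; apply: continuousN; exact: cI.
- split; under [X in continuous X]funext do rewrite raddfD /=.
  + exact: cD.
  + exact: cD.
- split.
  + under [X in continuous X]funext do rewrite ReM -mulNr.
    apply: cD; first exact: cM.
    by apply: cM => // p; apply: continuousN; exact: cIF.
  + under [X in continuous X]funext do rewrite ImM.
    by apply: cD; exact: cM.
Qed.

(** Each row of a unitary matrix has norm one, by the diagonal of [X *m (conjM X)^T]. *)
Lemma unitary_entry_bound (X : 'M[C]_n) i j : unitary X ->
  `|complex.Re (X i j)| <= 1 /\ `|complex.Im (X i j)| <= 1.
Proof.
move=> /(congr1 (fun M : 'M[C]_n => complex.Re (M i i))).
rewrite !mxE eqxx /= raddf_sum /= => h.
have sq m : complex.Re (X i m * (conjM X)^T m i) =
    complex.Re (X i m) ^+ 2 + complex.Im (X i m) ^+ 2.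
  by rewrite !mxE ReM Re_conjc Im_conjc; ring.
have : complex.Re (X i j) ^+ 2 + complex.Im (X i j) ^+ 2 <= 1.
  rewrite -h (bigD1 j) //= -sq lerDl sumr_ge0 // => m _.
  by rewrite sq addr_ge0 // sqr_ge0.
have := sqr_ge0 (complex.Re (X i j)); have := sqr_ge0 (complex.Im (X i j)).
move=> p q s; rewrite !ler_norml; split; apply/andP; split; nra.
Qed.

Lemma starpoly_bounded F : starpoly F -> exists B : R, forall X, unitary X ->
  `|complex.Re (F X)| <= B /\ `|complex.Im (F X)| <= B.
Proof.
elim=> {F} [c|i j|F _ [B hB]|F G _ [B hB] _ [B' hB']|F G _ [B hB] _ [B' hB']].
- exists (`|complex.Re c| + `|complex.Im c|) => X _.
  by split; rewrite ?lerDl ?lerDr.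
- by exists 1 => X hX; exact: unitary_entry_bound.
- by exists B => X /hB; rewrite Re_conjc Im_conjc normrN.
- exists (B + B') => X hX; rewrite !raddfD /=.
  have [h1 h2] := hB X hX; have [h3 h4] := hB' X hX.
  by split; apply: (le_trans (ler_normD _ _)); apply: lerD.
(* Each part of a product is a sum of two products of parts, whence the doubled bound. *)
- exists (B * B' + B * B') => X hX; rewrite ReM ImM.
  have [h1 h2] := hB X hX; have [h3 h4] := hB' X hX.
  by split; [apply: (le_trans (ler_normB _ _))|
             apply: (le_trans (ler_normD _ _))];
    apply: lerD; rewrite normrM ler_pM.
Qed.

End StarPolynomials.

(** * Expectation of star-polynomials under the Haar law *)

Section HaarExpectation.
Set Implicit Arguments.
Unset Strict Implicit.
Variables (R : realType) (n : nat).
Local Notation C := R[i].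
Variables (d : measure_display) (T : measurableType d) (P : probability T R).
Variable U : T -> 'M[C]_n.
Hypothesis haarU : haar_unitary P U.
Implicit Types F G : 'M[C]_n -> C.

Let unitU w : unitary (U w).
Proof. by have [h _ _] := haarU; exact: h. Qed.

Definition cexp F : C :=
  (Rintegral P setT (fun w => complex.Re (F (U w))) +i*
   Rintegral P setT (fun w => complex.Im (F (U w))))%C.

Lemma starpoly_measurable F : starpoly F ->
  measurable_fun setT (fun w => complex.Re (F (U w))) /\
  measurable_fun setT (fun w => complex.Im (F (U w))).
Proof.
elim=> {F} [c|i j|F _ [cR cI]|F G _ [cRF cIF] _ [cRG cIG]|
            F G _ [cRF cIF] _ [cRG cIG]].
- by split; apply: measurable_cst.
- by have [_ h _] := haarU; exact: h.
- split.
  + by under eq_fun do rewrite Re_conjc.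
  + by under eq_fun do rewrite Im_conjc; exact: measurableT_comp.
- by split; under eq_fun do rewrite raddfD /=; exact: measurable_funD.
- split.
  + under eq_fun do rewrite ReM.
    by apply: measurable_funB; exact: measurable_funM.
  + under eq_fun do rewrite ImM.
    by apply: measurable_funD; exact: measurable_funM.
Qed.

Lemma starpoly_integrable F : starpoly F ->
  P.-integrable setT (EFin \o (fun w => complex.Re (F (U w)))) /\
  P.-integrable setT (EFin \o (fun w => complex.Im (F (U w)))).
Proof.
move=> hF; have [mR mI] := starpoly_measurable hF.
have [B hB] := starpoly_bounded hF.
have Pfin : (P setT < +oo)%E by rewrite probability_setT ltry.
split; apply: measurable_bounded_integrable => //.
- exists B; split; first exact: num_real.
  by move=> x Bx w _ /=; apply: le_trans (ltW Bx); have [] := hB _ (unitU w).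
- exists B; split; first exact: num_real.
  by move=> x Bx w _ /=; apply: le_trans (ltW Bx); have [] := hB _ (unitU w).
Qed.

(** Agreement on U(n) suffices because [U] takes its values there; this is what allows trace
    identities valid only for unitary X to be averaged. *)
Lemma eq_cexp F G : (forall X, unitary X -> F X = G X) -> cexp F = cexp G.
Proof.
move=> h; rewrite /cexp.
by under eq_Rintegral => w _ do rewrite h //;
  under [in X in (_ +i* X)%C]eq_Rintegral => w _ do rewrite h //.
Qed.

Lemma cexp_cst c : cexp (fun=> c) = c.
Proof.
have cst (r : R) : Rintegral P setT (fun=> r) = r.
  have P1 : (P : {measure set T -> \bar R}) setT = 1%E := probability_setT P.
  by rewrite /Rintegral integral_cst // P1 mule1.
by rewrite /cexp !cst; case: c.
Qed.

Lemma cexpD F G : starpoly F -> starpoly G ->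
  cexp (fun X => F X + G X) = cexp F + cexp G.
Proof.
move=> /starpoly_integrable[iRF iIF] /starpoly_integrable[iRG iIG].
apply/eqP; rewrite eq_complex /=; apply/andP; split; apply/eqP.
- by rewrite -RintegralD //; apply: eq_Rintegral => w _; rewrite raddfD.
- by rewrite -RintegralD //; apply: eq_Rintegral => w _; rewrite raddfD.
Qed.

Lemma cexpZ c F : starpoly F -> cexp (fun X => c * F X) = c * cexp F.
Proof.
move=> /starpoly_integrable[iRF iIF].
have iZ r f : P.-integrable setT (EFin \o f) ->
    P.-integrable setT (EFin \o (fun w : T => r * f w)).
  move=> hf; rewrite (_ : _ \o _ = fun w => (r%:E * (f w)%:E)%E) //.
  exact: integrableZl.
apply/eqP; rewrite eq_complex ReM ImM /=; apply/andP; split; apply/eqP.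
- under eq_Rintegral do rewrite ReM.
  by rewrite RintegralB ?RintegralZl //; exact: iZ.
- under eq_Rintegral do rewrite ImM.
  by rewrite RintegralD ?RintegralZl //; exact: iZ.
Qed.

Lemma cexpN F : starpoly F -> cexp (fun X => - F X) = - cexp F.
Proof.
move=> hF; rewrite -mulN1r -cexpZ //.
by apply: eq_cexp => X _; rewrite mulN1r.
Qed.

Lemma cexpB F G : starpoly F -> starpoly G ->
  cexp (fun X => F X - G X) = cexp F - cexp G.
Proof. by move=> hF hG; rewrite cexpD ?cexpN //; exact: sp_opp. Qed.

Lemma cexp_sum (I : Type) (r : seq I) (F : I -> 'M[C]_n -> C) :
  (forall i, starpoly (F i)) ->
  cexp (fun X => \sum_(i <- r) F i X) = \sum_(i <- r) cexp (F i).
Proof.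
move=> hF; elim: r => [|i r ih].
  rewrite big_nil -[RHS](cexp_cst 0).
  by apply: eq_cexp => X _; rewrite big_nil.
rewrite big_cons -ih -cexpD //; last exact: sp_sum.
by apply: eq_cexp => X _; rewrite big_cons.
Qed.

(** Left invariance enters through this lemma alone: both parts of [F] are continuous in (Re X, Im
    X), so each is a legitimate test function. *)
Lemma cexp_invariant V F : unitary V -> starpoly F ->
  cexp (fun X => F (V *m X)) = cexp F.
Proof.
move=> hV /starpoly_continuous[cR cI]; have [_ _ inv] := haarU.
rewrite /cexp /Rintegral; congr (fine _ +i* fine _)%C.
- by etransitivity; [|etransitivity; [exact: (inv V hV _ cR)|]];
    apply: eq_integral => w _ /=; rewrite complexifyK.
- by etransitivity; [|etransitivity; [exact: (inv V hV _ cI)|]];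
    apply: eq_integral => w _ /=; rewrite complexifyK.
Qed.

End HaarExpectation.

(** * Hermitian and complex symmetric matrices built from a unitary and a real diagonal *)

Section QuadraticForms.
Set Implicit Arguments.
Unset Strict Implicit.
Variables (R : realType) (n : nat).
Local Notation C := R[i].
Implicit Types (s : 'I_n -> R) (X V : 'M[C]_n) (p : 'I_n -> C).

Definition cdiag s : 'M[C]_n := diag_mx (\row_j ((s j)%:C)%C).
Definition hermf s X : 'M[C]_n := X *m cdiag s *m (conjM X)^T.
Definition symf s X : 'M[C]_n := X *m cdiag s *m X^T.

Lemma conjMM X V : conjM (X *m V) = conjM X *m conjM V.
Proof. exact: map_mxM. Qed.

Lemma conjMT X : conjM X^T = (conjM X)^T.
Proof. by rewrite /conjM map_trmx. Qed.

Lemma conjMK X : conjM (conjM X) = X.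
Proof. by apply/matrixP => i j; rewrite !mxE conjcK. Qed.

Lemma conjM_cdiag s : conjM (cdiag s) = cdiag s.
Proof.
by apply/matrixP => i j; rewrite !mxE rmorphMn /=; congr (_ *+ _);
  exact: conjc_real.
Qed.

Lemma tr_cdiag s : (cdiag s)^T = cdiag s.
Proof. exact: tr_diag_mx. Qed.

Lemma hermf_mul s V X : hermf s (V *m X) = V *m hermf s X *m (conjM V)^T.
Proof. by rewrite /hermf conjMM trmx_mul !mulmxA. Qed.

Lemma symf_mul s V X : symf s (V *m X) = V *m symf s X *m V^T.
Proof. by rewrite /symf trmx_mul !mulmxA. Qed.

Lemma tr_symf s X : (symf s X)^T = symf s X.
Proof. by rewrite /symf !trmx_mul trmxK tr_cdiag mulmxA. Qed.

Lemma symf_sym s X a b : symf s X a b = symf s X b a.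
Proof. by rewrite -[in LHS]tr_symf mxE. Qed.

Lemma conj_hermf s X : conjM (hermf s X) = (hermf s X)^T.
Proof.
by rewrite /hermf !conjMM !trmx_mul trmxK tr_cdiag conjM_cdiag conjMT conjMK
  mulmxA.
Qed.

Lemma hermf_conj s X a b : (hermf s X a b)^*%C = hermf s X b a.
Proof. by have /matrixP/(_ a b) := conj_hermf s X; rewrite !mxE. Qed.

Lemma hermfE s X a b :
  hermf s X a b = \sum_j X a j * ((s j)%:C)%C * (X b j)^*%C.
Proof.
by rewrite !mxE; apply: eq_bigr => j _; rewrite mul_mx_diag !mxE.
Qed.

Lemma symfE s X a b : symf s X a b = \sum_j X a j * ((s j)%:C)%C * X b j.
Proof.
by rewrite !mxE; apply: eq_bigr => j _; rewrite mul_mx_diag !mxE.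
Qed.

Lemma sp_hermf s a b : starpoly (fun X => hermf s X a b).
Proof.
under [X in starpoly X]funext do rewrite hermfE.
apply: sp_sum => j; apply: sp_mul; last by apply: sp_conj; exact: sp_entry.
by apply: sp_mul; [exact: sp_entry|exact: sp_const].
Qed.

Lemma sp_symf s a b : starpoly (fun X => symf s X a b).
Proof.
under [X in starpoly X]funext do rewrite symfE.
apply: sp_sum => j; apply: sp_mul; last exact: sp_entry.
by apply: sp_mul; [exact: sp_entry|exact: sp_const].
Qed.

Lemma unitaryV X : unitary X -> (conjM X)^T *m X = 1%:M.
Proof. exact: mulmx1C. Qed.

Lemma unitaryVT X : unitary X -> X^T *m conjM X = 1%:M.
Proof. by move=> /unitaryV/(congr1 trmx); rewrite trmx_mul trmxK trmx1. Qed.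

(** Cyclicity of the trace brings X^* next to X, so the trace is the same for every unitary X. *)
Lemma sum_hermf_diag s X : unitary X ->
  \sum_a hermf s X a a = ((\sum_j s j)%:C)%C.
Proof.
move=> /unitaryV hX; rewrite -/(mxtrace (hermf s X)) /hermf mxtrace_mulC.
rewrite mulmxA hX mul1mx /cdiag mxtrace_diag rmorph_sum.
by apply: eq_bigr => j _; rewrite mxE.
Qed.

Lemma trace_cdiag_sqr s : \tr (cdiag s *m cdiag s) = ((\sum_j s j ^+ 2)%:C)%C.
Proof.
rewrite /cdiag mulmx_diag mxtrace_diag rmorph_sum.
by apply: eq_bigr => j _; rewrite !mxE expr2 rmorphM.
Qed.

Lemma sum_hermf_sqr s X : unitary X ->
  \sum_a \sum_b hermf s X a b * hermf s X b a = ((\sum_j s j ^+ 2)%:C)%C.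
Proof.
move=> /unitaryV hX; rewrite -trace_cdiag_sqr.
transitivity (\tr (hermf s X *m hermf s X)).
  by apply: eq_bigr => a _; rewrite mxE.
rewrite /hermf !mulmxA -[X in \tr (X *m _)]mulmxA.
rewrite mxtrace_mulC !mulmxA hX mul1mx -!mulmxA; congr (\tr (_ *m _)).
by rewrite mulmxA hX mul1mx.
Qed.

(** The sum is tr W W^*; the inner product of X^T and conj X, and after a cyclic shift that of X^*
    and X, collapse to the identity. *)
Lemma sum_symf_sqr s X : unitary X ->
  \sum_a \sum_b symf s X a b * (symf s X a b)^*%C = ((\sum_j s j ^+ 2)%:C)%C.
Proof.
move=> uX; have hX := unitaryV uX; have hX' := unitaryVT uX.
rewrite -trace_cdiag_sqr.
transitivity (\tr (symf s X *m (conjM (symf s X))^T)).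
  by apply: eq_bigr => a _; rewrite mxE; apply: eq_bigr => b _; rewrite !mxE.
rewrite /symf !conjMM !trmx_mul conjMT trmxK conjM_cdiag tr_cdiag !mulmxA.
rewrite mxtrace_mulC !mulmxA hX mul1mx -!mulmxA; congr (\tr (_ *m _)).
by rewrite mulmxA hX' mul1mx.
Qed.

(** * Transformation under phases, permutations and a rational reflection *)

Definition phase p : 'M[C]_n := diag_mx (\row_i p i).

Lemma unitary_phase p : (forall i, p i * (p i)^*%C = 1) -> unitary (phase p).
Proof.
move=> hp; apply/matrixP => i j; rewrite /unitary /phase mul_diag_mx !mxE.
rewrite rmorphMn /= eq_sym; case: eqP => [->|_]; last by rewrite mulr0.
by rewrite !mulr1n hp.
Qed.

Lemma hermf_phase s p X a b :
  hermf s (phase p *m X) a b = p a * (p b)^*%C * hermf s X a b.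
Proof.
have -> : hermf s (phase p *m X) =
    phase p *m hermf s X *m diag_mx (\row_i (p i)^*%C).
  rewrite hermf_mul /phase; congr (_ *m _); apply/matrixP => i j.
  by rewrite !mxE rmorphMn /= eq_sym; case: eqP => [->|].
by rewrite mul_mx_diag /phase mul_diag_mx !mxE; ring.
Qed.

(** No conjugate appears, in contrast to [hermf_phase]; this difference separates [W] from [H]. *)
Lemma symf_phase s p X a b :
  symf s (phase p *m X) a b = p a * p b * symf s X a b.
Proof.
by rewrite symf_mul /phase tr_diag_mx mul_mx_diag mul_diag_mx !mxE; ring.
Qed.

Lemma unitary_perm (g : 'S_n) : unitary (perm_mx g : 'M[C]_n).
Proof.
by rewrite /unitary /conjM map_perm_mx tr_perm_mx -perm_mxM mulgV perm_mx1.
Qed.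

Lemma hermf_perm s (g : 'S_n) X a b :
  hermf s (perm_mx g *m X) a b = hermf s X (g a) (g b).
Proof.
by rewrite hermf_mul /conjM map_perm_mx tr_perm_mx -row_permE -col_permE !mxE.
Qed.

Lemma symf_perm s (g : 'S_n) X a b :
  symf s (perm_mx g *m X) a b = symf s X (g a) (g b).
Proof. by rewrite symf_mul tr_perm_mx -row_permE -col_permE !mxE. Qed.

(* The reflection along e_a + 2 e_b: its entries are the rational numbers 3/5
   and 4/5, so no square root is needed. *)
Definition reflection (a b : 'I_n) : 'M[C]_n :=
  let v : 'cV[C]_n := delta_mx a 0 + 2%:R *: delta_mx b 0 in
  1%:M - (2%:R / 5%:R) *: (v *m v^T).

Lemma conjM_reflection a b : conjM (reflection a b) = reflection a b.
Proof.
rewrite /reflection /conjM map_mxB map_scalar_mx rmorph1 map_mxZ map_mxM.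
rewrite -map_trmx map_mxD map_mxZ !map_delta_mx.
by rewrite rmorphM fmorphV !rmorph_nat.
Qed.

(** For A = v v^T one has A^2 = |v|^2 A = 5 A, so (1 - c A)^2 = 1 - (2 c - 5 c^2) A, and c = 2/5
    makes the bracket vanish. *)
Lemma unitary_reflection a b : a != b -> unitary (reflection a b).
Proof.
move=> ab; rewrite /unitary conjM_reflection.
rewrite /reflection; set v : 'cV[C]_n := _ + _.
have vv : v^T *m v = 5%:R%:M.
  have -> : v^T = delta_mx 0 a + 2%:R *: delta_mx 0 b.
    by rewrite /v linearD linearZ /= !trmx_delta.
  rewrite /v mulmxDl !mulmxDr -!scalemxAl.
  rewrite -!scalemxAr !mul_delta_mx_cond !eqxx [b == a]eq_sym !(negbTE ab) /=.
  rewrite !mulr0n !scaler0 addr0 add0r !mulr1n scalerA.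
  apply/matrixP => i j; rewrite !ord1 !mxE !eqxx !mulr1n; ring.
set A := v *m v^T; set c := _ / _.
have AA : A *m A = 5%:R *: A.
  by rewrite /A mulmxA -[v *m v^T *m v]mulmxA vv mul_mx_scalar -scalemxAl.
have -> : (1%:M - c *: A)^T = 1%:M - c *: A.
  by rewrite linearB linearZ /= trmx1 /A trmx_mul trmxK.
rewrite mulmxBl mul1mx -scalemxAl mulmxBr mulmx1 -scalemxAr AA.
rewrite -addrA -opprD !scalerBr !scalerA addrA -scalerDl -scalerBl.
rewrite [X in X *: A](_ : _ = 0) ?scale0r ?subr0 //.
by rewrite /c; field.
Qed.

Lemma reflection_row a b i : a != b ->
  reflection a b a i = 3%:R / 5%:R * (i == a)%:R - 4%:R / 5%:R * (i == b)%:R.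
Proof.
move=> ab.
rewrite /reflection !mxE big_ord1 !mxE eqxx (negbTE ab) /= !andbT.
rewrite [a == i]eq_sym; case: (i == a); case: (i == b); by field.
Qed.

(** The entry (a, a) involves only row a of the reflection, which is 3/5 at a and -4/5 at b. *)
Lemma reflection_conjugate (M : 'M[C]_n) a b : a != b ->
  (reflection a b *m M *m (reflection a b)^T) a a =
  9%:R / 25%:R * M a a + 16%:R / 25%:R * M b b -
  12%:R / 25%:R * (M a b + M b a).
Proof.
move=> ab.
have row_sum (f : 'I_n -> C) : \sum_i reflection a b a i * f i =
    3%:R / 5%:R * f a - 4%:R / 5%:R * f b.
  under eq_bigr do rewrite reflection_row // mulrBl -!mulrA.
  rewrite sumrB -!mulr_sumr.
  under eq_bigr do rewrite mulr_natl mulrb.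
  under [X in _ - _ * (_ * X)]eq_bigr do rewrite mulr_natl mulrb.
  by rewrite -!big_mkcond !big_pred1_eq /= !mulrA.
transitivity (\sum_j reflection a b a j * (\sum_i reflection a b a i * M i j)).
  by rewrite !mxE; apply: eq_bigr => j _; rewrite !mxE mulrC.
by rewrite row_sum !row_sum; field.
Qed.

End QuadraticForms.

(** * Relations between second moments forced by invariance *)

Section Moments.
Set Implicit Arguments.
Unset Strict Implicit.
Variables (R : realType) (n : nat).
Local Notation C := R[i].
Variables (d : measure_display) (T : measurableType d) (P : probability T R).
Variable U : T -> 'M[C]_n.
Hypothesis haarU : haar_unitary P U.
Variables s t : 'I_n -> R.
Local Notation E := (cexp P U).
Local Notation H := (hermf s).
Local Notation W := (symf t).

Definition hmoment a b c e := E (fun X => H X a b * H X c e).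
Definition wmoment a b c e := E (fun X => W X a b * (W X c e)^*%C).

Let sp_HH a b c e : starpoly (fun X => H X a b * H X c e).
Proof. by apply: sp_mul; exact: sp_hermf. Qed.

Let sp_WW a b c e : starpoly (fun X => W X a b * (W X c e)^*%C).
Proof.
by apply: sp_mul; [exact: sp_symf|apply: sp_conj; exact: sp_symf].
Qed.

(** Moments are shown to vanish by exhibiting a unitary that changes their sign. *)
Lemma eq_opp_eq0 (x : C) : x = - x -> x = 0.
Proof.
by move/eqP; rewrite -subr_eq0 opprK -mulr2n mulrn_eq0 /= => /eqP.
Qed.

Lemma hmoment_phase p a b c e : (forall i, p i * (p i)^*%C = 1) ->
  hmoment a b c e =
  p a * (p b)^*%C * (p c * (p e)^*%C) * hmoment a b c e.
Proof.
move=> hp; rewrite -[LHS](cexp_invariant haarU (unitary_phase hp) (sp_HH _ _ _ _)).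
rewrite /hmoment -(cexpZ haarU _ (sp_HH _ _ _ _)); apply: (eq_cexp haarU) => X _.
by rewrite !hermf_phase; ring.
Qed.

Lemma wmoment_phase p a b c e : (forall i, p i * (p i)^*%C = 1) ->
  wmoment a b c e =
  p a * p b * (p c * p e)^*%C * wmoment a b c e.
Proof.
move=> hp; rewrite -[LHS](cexp_invariant haarU (unitary_phase hp) (sp_WW _ _ _ _)).
rewrite /wmoment -(cexpZ haarU _ (sp_WW _ _ _ _)); apply: (eq_cexp haarU) => X _.
by rewrite !symf_phase !rmorphM /=; ring.
Qed.

(** Kills moments in which the index a occurs an odd number of times. *)
Definition signflip (a i : 'I_n) : C := if i == a then -1 else 1.
(** Kills moments such as E H_ab^2 and E W_aa conj(W_bb), in which a occurs twice and a sign flip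
    has no effect. *)
Definition quarterturn (a i : 'I_n) : C := if i == a then 'i%C else 1.

Lemma signflipP a i : signflip a i * (signflip a i)^*%C = 1.
Proof.
by rewrite /signflip; case: ifP; rewrite ?rmorphN rmorph1 ?mulrNN mulr1.
Qed.

Lemma conji : ('i%C : C)^*%C = - 'i%C.
Proof. by apply/eqP; rewrite eq_complex /= oppr0 !eqxx. Qed.

Lemma mulii : 'i%C * 'i%C = -1 :> C.
Proof. by rewrite -expr2 sqr_i. Qed.

Lemma quarterturnP a i : quarterturn a i * (quarterturn a i)^*%C = 1.
Proof.
rewrite /quarterturn; case: ifP; rewrite ?rmorph1 ?mulr1 //.
by rewrite conji mulrN mulii opprK.
Qed.

(** The scalar phase i fixes [H] and multiplies [W] by i^2 = -1. *)
Lemma cross_moment0 a b c e : E (fun X => H X a b * W X c e) = 0.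
Proof.
have hp (i : 'I_n) : ('i%C : C) * 'i%C^*%C = 1.
  by rewrite conji mulrN mulii opprK.
have sp : starpoly (fun X => H X a b * W X c e).
  by apply: sp_mul; [exact: sp_hermf|exact: sp_symf].
apply: eq_opp_eq0; rewrite -(cexpN haarU sp).
rewrite -[LHS](cexp_invariant haarU (unitary_phase hp) sp).
apply: (eq_cexp haarU) => X _; rewrite hermf_phase symf_phase hp // mulii; ring.
Qed.

(** The index a occurs once, or three times if c = a, so the sign flip at a reverses the moment. *)
Lemma hmoment_odd a b c : a != b -> hmoment a c c b = 0.
Proof.
move=> ab; apply: eq_opp_eq0.
rewrite {1}(hmoment_phase _ _ _ _ (signflipP a)) /signflip eqxx.
rewrite [b == a]eq_sym (negbTE ab).
by case: (c == a); rewrite ?rmorphN ?rmorph1; ring.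
Qed.

Lemma wmoment_odd a b c : a != b -> wmoment a c c b = 0.
Proof.
move=> ab; apply: eq_opp_eq0.
rewrite {1}(wmoment_phase _ _ _ _ (signflipP a)) /signflip eqxx.
rewrite [b == a]eq_sym (negbTE ab).
by case: (c == a); rewrite ?rmorphM ?rmorphN ?rmorph1; ring.
Qed.

(** The combination is a list of coefficients with index data, so that an expanded square is
    averaged in one step. *)
Lemma cexp_lin (I : Type) (r : seq (C * I)) (G : I -> 'M[C]_n -> C) :
  (forall i, starpoly (G i)) ->
  E (fun X => \sum_(q <- r) q.1 * G q.2 X) = \sum_(q <- r) q.1 * E (G q.2).
Proof.
move=> hG; rewrite (cexp_sum haarU) => [|q].
  by apply: eq_bigr => q _; rewrite (cexpZ haarU).
by apply: sp_mul => //; exact: sp_const.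
Qed.

Lemma hmoment_perm (g : 'S_n) a b c e :
  hmoment a b c e = hmoment (g a) (g b) (g c) (g e).
Proof.
rewrite -[LHS](cexp_invariant haarU (unitary_perm R g) (sp_HH _ _ _ _)).
by apply: (eq_cexp haarU) => X _; rewrite !hermf_perm.
Qed.

Lemma wmoment_perm (g : 'S_n) a b c e :
  wmoment a b c e = wmoment (g a) (g b) (g c) (g e).
Proof.
rewrite -[LHS](cexp_invariant haarU (unitary_perm R g) (sp_WW _ _ _ _)).
by apply: (eq_cexp haarU) => X _; rewrite !symf_perm.
Qed.

(* 337/625 = (3/5)^4 + (4/5)^4 and 288/625 = 2 (3/5)^2 (4/5)^2. *)
Lemma quartic_solve (x w y : C) :
  y = 337%:R / 625%:R * y + 288%:R / 625%:R * (x + w) -> y = x + w.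
Proof.
move=> key; have nz : (288%:R / 625%:R : C) != 0.
  by apply: mulf_neq0; rewrite ?invr_eq0 pnatr_eq0.
apply: (mulfI nz); transitivity (y - 337%:R / 625%:R * y); first by field.
by rewrite {1}key; field.
Qed.

Lemma hmoment_aaab a b : a != b ->
  hmoment a a a b = 0 /\ hmoment a a b a = 0.
Proof.
move=> ab; split; first exact: hmoment_odd.
by rewrite -(@hmoment_odd b a a) 1?eq_sym //; apply: (eq_cexp haarU) => X _;
  rewrite mulrC.
Qed.

Lemma hmoment_abab a b : a != b -> hmoment a b a b = 0.
Proof.
move=> ab; apply: eq_opp_eq0.
rewrite {1}(hmoment_phase _ _ _ _ (quarterturnP a)) /quarterturn eqxx.
by rewrite [b == a]eq_sym (negbTE ab) rmorph1 mulr1 mulii mulN1r.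
Qed.

Lemma hmoment_diag a b : hmoment a a a a = hmoment b b b b.
Proof. by rewrite (hmoment_perm (tperm a b)) tpermL. Qed.

Lemma wmoment_diag a b : wmoment a a a a = wmoment b b b b.
Proof. by rewrite (wmoment_perm (tperm a b)) tpermL. Qed.

(** E H_aa^2 is unchanged when the reflection replaces H_aa by a combination of H_aa, H_bb, H_ab and
    H_ba. After the odd and unbalanced terms vanish, a linear equation for E H_aa^2 remains. *)
Lemma hmoment_reflection a b : a != b ->
  hmoment a a a a = hmoment a b b a + hmoment a a b b.
Proof.
move=> ab; have ba : b != a by rewrite eq_sym.
(* Terms of the square of 9/25 H_aa + 16/25 H_bb - 12/25 (H_ab + H_ba). *)
pose r : seq (C * ('I_n * 'I_n * 'I_n * 'I_n)) :=
  [:: (81%:R / 625%:R, (a, a, a, a)); (256%:R / 625%:R, (b, b, b, b));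
      (288%:R / 625%:R, (a, a, b, b)); (288%:R / 625%:R, (a, b, b, a));
      (144%:R / 625%:R, (a, b, a, b)); (144%:R / 625%:R, (b, a, b, a));
      (- 216%:R / 625%:R, (a, a, a, b)); (- 216%:R / 625%:R, (a, a, b, a));
      (- 384%:R / 625%:R, (b, b, b, a)); (- 384%:R / 625%:R, (b, b, a, b))].
pose G (q : 'I_n * 'I_n * 'I_n * 'I_n) X :=
  H X q.1.1.1 q.1.1.2 * H X q.1.2 q.2.
have : hmoment a a a a = \sum_(q <- r) q.1 * E (G q.2).
  rewrite -cexp_lin; last by move=> q; exact: sp_HH.
  rewrite -[LHS](cexp_invariant haarU (unitary_reflection R ab) (sp_HH _ _ _ _)).
  apply: (eq_cexp haarU) => X _.
  rewrite hermf_mul conjM_reflection reflection_conjugate //.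
  by rewrite /r /G !big_cons big_nil; cbn [fst snd]; field.
have GE q : E (G q) = hmoment q.1.1.1 q.1.1.2 q.1.2 q.2 by [].
rewrite /r !big_cons big_nil !GE; cbn [fst snd].
have [-> ->] := hmoment_aaab ab; have [-> ->] := hmoment_aaab ba.
rewrite (hmoment_abab ab) (hmoment_abab ba) -(hmoment_diag a b) => key.
by apply: quartic_solve; rewrite {1}key; field.
Qed.

Lemma wmoment_reflection a b : a != b ->
  wmoment a a a a = 2%:R * wmoment a b a b.
Proof.
move=> ab; have ba : b != a by rewrite eq_sym.
have odd i j : i != j -> wmoment i i i j = 0 /\ wmoment i j i i = 0.
  move=> ij; split; first exact: wmoment_odd.
  rewrite -(@wmoment_odd j i i) 1?eq_sym //; apply: (eq_cexp haarU) => X _.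
  by rewrite symf_sym.
have quart i j : i != j -> wmoment i i j j = 0.
  move=> ij; apply: eq_opp_eq0.
  rewrite {1}(wmoment_phase _ _ _ _ (quarterturnP i)) /quarterturn eqxx.
  by rewrite [j == i]eq_sym (negbTE ij) mulr1 rmorph1 mulii mulr1 mulN1r.
(* Terms of the squared modulus of 9/25 W_aa + 16/25 W_bb - 24/25 W_ab, since W_ab = W_ba. *)
pose r : seq (C * ('I_n * 'I_n * 'I_n * 'I_n)) :=
  [:: (81%:R / 625%:R, (a, a, a, a)); (256%:R / 625%:R, (b, b, b, b));
      (144%:R / 625%:R, (a, a, b, b)); (144%:R / 625%:R, (b, b, a, a));
      (576%:R / 625%:R, (a, b, a, b));
      (- 216%:R / 625%:R, (a, a, a, b)); (- 216%:R / 625%:R, (a, b, a, a));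
      (- 384%:R / 625%:R, (b, b, b, a)); (- 384%:R / 625%:R, (b, a, b, b))].
pose G (q : 'I_n * 'I_n * 'I_n * 'I_n) X :=
  W X q.1.1.1 q.1.1.2 * (W X q.1.2 q.2)^*%C.
have : wmoment a a a a = \sum_(q <- r) q.1 * E (G q.2).
  rewrite -cexp_lin; last by move=> q; exact: sp_WW.
  rewrite -[LHS](cexp_invariant haarU (unitary_reflection R ab) (sp_WW _ _ _ _)).
  apply: (eq_cexp haarU) => X _.
  rewrite symf_mul reflection_conjugate // [W X b a]symf_sym.
  rewrite /r /G !big_cons big_nil; cbn [fst snd].
  rewrite !(rmorphB, rmorphD, rmorphM, fmorphV, rmorph_nat).
  by rewrite [W X b a]symf_sym; field.
have GE q : E (G q) = wmoment q.1.1.1 q.1.1.2 q.1.2 q.2 by [].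
rewrite /r !big_cons big_nil !GE; cbn [fst snd].
have [-> ->] := odd _ _ ab; have [-> ->] := odd _ _ ba.
rewrite (quart _ _ ab) (quart _ _ ba) -(wmoment_diag a b) => key.
(* As 576 = 2 * 288, reading 2 x as x + x lets [quartic_solve] apply with both of its off-diagonal
   moments equal. *)
rewrite mulr_natl mulr2n.
by apply: quartic_solve; rewrite {1}key; field.
Qed.

End Moments.

(** * Values of the second moments *)

Section MomentValues.
Set Implicit Arguments.
Unset Strict Implicit.
Variables (R : realType) (n : nat).
Local Notation C := R[i].
Implicit Types s t : 'I_n -> R.

(** [hcoef_off] and [hcoef_diag] are the solution (x, w) of n^2 x + n w = tr S^2 and n^2 w + n x =
    (tr S)^2, where S = diag(s). Thus [hcoef_diag] is E H_aa H_bb for a != b, which is also the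
    excess of E H_aa^2 over E|H_ab|^2. *)
Definition hcoef_diag s : R :=
  ((\sum_j s j) ^+ 2 - (\sum_j s j ^+ 2) / n%:R) / (n%:R ^+ 2 - 1).
Definition hcoef_off s : R :=
  ((\sum_j s j ^+ 2) - (\sum_j s j) ^+ 2 / n%:R) / (n%:R ^+ 2 - 1).
(** The solution u of n^2 u + n u = tr T^2, where T = diag(t). *)
Definition wcoef t : R := (\sum_j t j ^+ 2) / (n%:R ^+ 2 + n%:R).

(** Double transitivity of the symmetric group: send a to c, then the image of b to e by a
    transposition that fixes c. *)
Lemma perm_pair (a b c e : 'I_n) : a != b -> c != e ->
  exists g : 'S_n, g a = c /\ g b = e.
Proof.
move=> ab ce; exists (tperm a c * tperm (tperm a c b) e)%g.
rewrite !permM tpermL [tperm _ e (tperm a c b)]tpermL; split=> //.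
have bc : tperm a c b != c.
  by rewrite -{2}(tpermL a c) (inj_eq perm_inj) eq_sym.
by apply: tpermD => //; rewrite eq_sym.
Qed.

Lemma sum_diag_off (x z : C) :
  \sum_(a < n) \sum_(b < n) (x + (a == b)%:R * z) = n%:R ^+ 2 * x + n%:R * z.
Proof.
under eq_bigr => a _.
  rewrite big_split /= sumr_const card_ord -mulr_suml.
  rewrite [X in _ + X * _](_ : _ = 1); last first.
    rewrite (bigD1 a) //= eqxx big1 ?addr0 // => b.
    by rewrite eq_sym => /negbTE ->.
  over.
by rewrite sumr_const card_ord -mulr_natl -[x *+ n]mulr_natl; ring.
Qed.

Variables (d : measure_display) (T : measurableType d) (P : probability T R).
Variable U : T -> 'M[C]_n.
Hypothesis haarU : haar_unitary P U.
Hypothesis n_gt1 : (1 < n)%N.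

(** Two distinct reference indices, 0 and 1, to which moments are transported by permutations. *)
Let a0 : 'I_n := Ordinal (ltnW n_gt1).
Let b0 : 'I_n := Ordinal n_gt1.
Let ab0 : a0 != b0. Proof. by []. Qed.

Let n_neq0 : (n%:R : C) != 0.
Proof. by rewrite pnatr_eq0 -lt0n ltnW. Qed.

Let nsq_neq0 : (n%:R ^+ 2 - 1 : C) != 0.
Proof.
rewrite subr_eq0 sqrf_eq1 negb_or (eqr_nat _ n 1) neq_ltn n_gt1 orbT /=.
by rewrite -subr_eq0 opprK natr1 pnatr_eq0.
Qed.

Let nsqD_neq0 : (n%:R ^+ 2 + n%:R : C) != 0.
Proof.
by rewrite -natrX -natrD pnatr_eq0 addn_eq0 negb_and -!lt0n (ltnW n_gt1) orbT.
Qed.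

Lemma hmoment_val s a b :
  hmoment P U s a b b a =
  (((hcoef_off s + (a == b)%:R * hcoef_diag s)%:C)%C).
Proof.
set x := hmoment P U s a0 b0 b0 a0.
set w := hmoment P U s a0 a0 b0 b0.
set y := hmoment P U s a0 a0 a0 a0.
have xE i j : hmoment P U s i j j i = x + (i == j)%:R * (y - x).
  case: eqP => [<-|/eqP ij].
    by rewrite (hmoment_diag haarU s i a0) mul1r addrC subrK.
  have [g [gi gj]] := perm_pair ij ab0.
  by rewrite mul0r addr0 (hmoment_perm haarU s g) gi gj.
have wE i j : hmoment P U s i i j j = w + (i == j)%:R * (y - w).
  case: eqP => [<-|/eqP ij].
    by rewrite (hmoment_diag haarU s i a0) mul1r addrC subrK.
  have [g [gi gj]] := perm_pair ij ab0.
  by rewrite mul0r addr0 (hmoment_perm haarU s g) gi gj.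
have yE : y = x + w by exact: (hmoment_reflection haarU s ab0).
have sp i j k l : starpoly (fun X => hermf s X i j * hermf s X k l).
  by apply: sp_mul; exact: sp_hermf.
(* First equation: average the constant tr H^2. Since y = x + w, the diagonal excess y - x in [xE]
   is w. *)
have T2 : (((\sum_j s j ^+ 2)%:C)%C) = n%:R ^+ 2 * x + n%:R * w.
  rewrite (_ : w = y - x); last by rewrite yE addrC addKr.
  rewrite -sum_diag_off -(cexp_cst P U (((\sum_j s j ^+ 2)%:C)%C)).
  under [RHS]eq_bigr do under eq_bigr do rewrite -xE.
  under [RHS]eq_bigr do rewrite -(cexp_sum haarU) //.
  rewrite -(cexp_sum haarU); last by move=> i; exact: sp_sum.
  by apply: (eq_cexp haarU) => X uX; rewrite sum_hermf_sqr.
(* Second equation: average the constant (tr H)^2; here the diagonal excess is x. *)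
have T1 : (((\sum_j s j)%:C)%C) ^+ 2 = n%:R ^+ 2 * w + n%:R * x.
  rewrite (_ : x = y - w); last by rewrite yE addrK.
  rewrite -sum_diag_off -[LHS](cexp_cst P U).
  under [RHS]eq_bigr do under eq_bigr do rewrite -wE.
  under [RHS]eq_bigr do rewrite -(cexp_sum haarU) //.
  rewrite -(cexp_sum haarU); last by move=> i; exact: sp_sum.
  apply: (eq_cexp haarU) => X uX; rewrite -(sum_hermf_diag s uX) expr2 mulr_suml.
  by apply: eq_bigr => i _; rewrite mulr_sumr.
have off : ((hcoef_off s)%:C)%C = x.
  rewrite /hcoef_off rmorphM fmorphV !rmorphB rmorphM fmorphV !rmorphXn.
  rewrite rmorph1 !rmorph_nat /= T1 T2; field.
  by rewrite nsq_neq0 n_neq0.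
have dia : ((hcoef_diag s)%:C)%C = w.
  rewrite /hcoef_diag rmorphM fmorphV !rmorphB !rmorphXn rmorphM fmorphV.
  rewrite rmorph1 !rmorph_nat /= T1 T2; field.
  by rewrite nsq_neq0 n_neq0.
rewrite xE rmorphD [X in _ = _ + X]rmorphM rmorph_nat /= off dia yE.
by rewrite [x + w]addrC addrK.
Qed.

Lemma wmoment_val t a b :
  wmoment P U t a b b a = (((1 + (a == b)%:R) * wcoef t)%:C)%C.
Proof.
set x := wmoment P U t a0 b0 a0 b0.
set y := wmoment P U t a0 a0 a0 a0.
have xE i j : wmoment P U t i j i j = x + (i == j)%:R * (y - x).
  case: eqP => [<-|/eqP ij].
    by rewrite (wmoment_diag haarU t i a0) mul1r addrC subrK.
  have [g [gi gj]] := perm_pair ij ab0.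
  by rewrite mul0r addr0 (wmoment_perm haarU t g) gi gj.
have yE : y = 2%:R * x by exact: (wmoment_reflection haarU t ab0).
(* The reflection leaves a single unknown, which tr W W^* alone determines. *)
have yx : y - x = x by rewrite yE; ring.
have sp i j k l : starpoly (fun X => symf t X i j * (symf t X k l)^*%C).
  by apply: sp_mul; [exact: sp_symf|apply: sp_conj; exact: sp_symf].
have T2 : (((\sum_j t j ^+ 2)%:C)%C) = n%:R ^+ 2 * x + n%:R * x.
  rewrite -{2}yx -sum_diag_off -[LHS](cexp_cst P U).
  under [RHS]eq_bigr do under eq_bigr do rewrite -xE.
  under [RHS]eq_bigr do rewrite -(cexp_sum haarU) //.
  rewrite -(cexp_sum haarU); last by move=> i; exact: sp_sum.
  by apply: (eq_cexp haarU) => X uX; rewrite sum_symf_sqr.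
have off : ((wcoef t)%:C)%C = x.
  rewrite /wcoef rmorphM fmorphV rmorphD rmorphXn.
  rewrite !rmorph_nat /= T2; field.
  by rewrite nsqD_neq0.
have -> : wmoment P U t a b b a = wmoment P U t a b a b.
  by apply: (eq_cexp haarU) => X _; rewrite [symf t X b a]symf_sym.
by rewrite xE yx rmorphM rmorphD rmorph1 rmorph_nat /= off mulrDl mul1r.
Qed.

End MomentValues.

(** * Block form of the reduced covariance matrix and of its square *)

Section CovarianceBlocks.
Set Implicit Arguments.
Unset Strict Implicit.
Variables (R : realType) (n : nat) (z : 'I_n -> R).
Local Notation C := R[i].
Local Notation Re := (@complex.Re R).
Local Notation Im := (@complex.Im R).

Definition zplus (j : 'I_n) : R := (z j + (z j)^-1) / 2.
Definition zminus (j : 'I_n) : R := (z j - (z j)^-1) / 2.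

Local Notation H := (hermf zplus).
Local Notation W := (symf zminus).

Lemma Mn_entry (X : 'M[C]_n) i j :
  Mn z X i j = \sum_m (Defs.eta X i (lshift n m) * z m * Defs.eta X j (lshift n m) +
                       Defs.eta X i (rshift n m) * (z m)^-1 * Defs.eta X j (rshift n m)).
Proof.
rewrite !mxE big_split_ord big_split /=.
congr (_ + _); apply: eq_bigr => m _; rewrite /Zhat mul_mx_diag !mxE.
  by rewrite (unsplitK (inl m)).
by rewrite (unsplitK (inr m)).
Qed.

Lemma Re_hermf s (X : 'M[C]_n) a b : Re (hermf s X a b) =
  \sum_m s m * (Re (X a m) * Re (X b m) + Im (X a m) * Im (X b m)).
Proof.
rewrite hermfE raddf_sum; apply: eq_bigr => m _ /=.
by case: (X a m) (X b m) => [? ?] [? ?] /=; ring.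
Qed.

Lemma Im_hermf s (X : 'M[C]_n) a b : Im (hermf s X a b) =
  \sum_m s m * (Im (X a m) * Re (X b m) - Re (X a m) * Im (X b m)).
Proof.
rewrite hermfE raddf_sum; apply: eq_bigr => m _ /=.
by case: (X a m) (X b m) => [? ?] [? ?] /=; ring.
Qed.

Lemma Re_symf s (X : 'M[C]_n) a b : Re (symf s X a b) =
  \sum_m s m * (Re (X a m) * Re (X b m) - Im (X a m) * Im (X b m)).
Proof.
rewrite symfE raddf_sum; apply: eq_bigr => m _ /=.
by case: (X a m) (X b m) => [? ?] [? ?] /=; ring.
Qed.

Lemma Im_symf s (X : 'M[C]_n) a b : Im (symf s X a b) =
  \sum_m s m * (Re (X a m) * Im (X b m) + Im (X a m) * Re (X b m)).
Proof.
rewrite symfE raddf_sum; apply: eq_bigr => m _ /=.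
by case: (X a m) (X b m) => [? ?] [? ?] /=; ring.
Qed.

(** Since Z = Z+ + Z- and Z^-1 = Z+ - Z-, [Zhat] is diag(Z+, Z+) + diag(Z-, -Z-). The first term
    commutes with the complex structure and yields the real form of H; the second anticommutes with
    it and yields that of W composed with conjugation. *)
Lemma Mn_block (X : 'M[C]_n) :
  Mn z X = block_mx (reM (H X) + reM (W X)) (imM (H X) - imM (W X))
                    (- imM (H X) - imM (W X)) (reM (H X) - reM (W X)).
Proof.
have addE (A B : 'M[R]_n) a b : (A + B) a b = A a b + B a b by rewrite mxE.
have oppE (A : 'M[R]_n) a b : (- A) a b = - A a b by rewrite mxE.
have reE (A : 'M[C]_n) a b : reM A a b = Re (A a b) by rewrite mxE.
have imE (A : 'M[C]_n) a b : imM A a b = Im (A a b) by rewrite mxE.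
apply/matrixP => i j; rewrite Mn_entry /Defs.eta.
case: (split_ordP i) => a ->; case: (split_ordP j) => b ->.
- rewrite block_mxEul !(addE, oppE, reE) Re_hermf Re_symf -big_split.
  apply: eq_bigr => m _; rewrite !block_mxEul !block_mxEur !mxE /zplus /zminus.
  (* The identity is linear in the inverse, so it is generalized to an atom before [field]. *)
  by rewrite /=; move: (z m)^-1 => zi; field.
- rewrite block_mxEur !(addE, oppE, imE) Im_hermf Im_symf -sumrB.
  apply: eq_bigr => m _; rewrite !block_mxEul !block_mxEur !block_mxEdl.
  by rewrite !block_mxEdr !mxE /zplus /zminus /=; move: (z m)^-1 => zi; field.
- rewrite block_mxEdl !(addE, oppE, imE) Im_hermf Im_symf -sumrN -sumrB.
  apply: eq_bigr => m _; rewrite !block_mxEul !block_mxEur !block_mxEdl.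
  by rewrite !block_mxEdr !mxE /zplus /zminus /=; move: (z m)^-1 => zi; field.
- rewrite block_mxEdr !(addE, oppE, reE) Re_hermf Re_symf -sumrB.
  apply: eq_bigr => m _; rewrite !block_mxEdl !block_mxEdr !mxE.
  by rewrite /zplus /zminus /=; move: (z m)^-1 => zi; field.
Qed.

Variables (k : nat) (hk : (k <= n)%N).
Local Notation wd := (widen_ord hk).

(** For S = H_k^2 - W_k conj(W_k) and Q = H_k W_k - W_k conj(H_k), this is the entry (a, b) of S + e
    Q. The values e = 1 and e = -1 suffice to express all four real blocks. The factor
    [H X (wd b) (wd c)] is the conjugate of H_cb. *)
Definition JMfun (e : C) (a b : 'I_k) (X : 'M[C]_n) : C :=
  \sum_(c < k) (H X (wd a) (wd c) * H X (wd c) (wd b)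
              - W X (wd a) (wd c) * (W X (wd c) (wd b))^*%C
              + e * (H X (wd a) (wd c) * W X (wd c) (wd b)
                     - H X (wd b) (wd c) * W X (wd a) (wd c))).

Definition compress (M : 'M[R]_n) : 'M[R]_k := mxsub wd wd M.

Lemma Mnk_block (X : 'M[C]_n) :
  Mnk hk z X =
  block_mx (compress (reM (H X)) + compress (reM (W X)))
           (compress (imM (H X)) - compress (imM (W X)))
           (- compress (imM (H X)) - compress (imM (W X)))
           (compress (reM (H X)) - compress (reM (W X))).
Proof.
have sell a : sel hk (lshift k a) = lshift n (wd a).
  by rewrite /sel (unsplitK (inl a)).
have selr a : sel hk (rshift k a) = rshift n (wd a).
  by rewrite /sel (unsplitK (inr a)).
apply/matrixP => i j; rewrite /Mnk mxE Mn_block.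
case: (split_ordP i) => a ->; case: (split_ordP j) => b ->; rewrite ?sell ?selr.
- by rewrite !block_mxEul !mxE.
- by rewrite !block_mxEur !mxE.
- by rewrite !block_mxEdl !mxE.
- by rewrite !block_mxEdr !mxE.
Qed.

Lemma JM_sqr_block (X : 'M[C]_n) :
  (Jmx R k *m Mnk hk z X) ^+ 2 =
  block_mx (\matrix_(a, b) Re (- JMfun 1 a b X))
           (\matrix_(a, b) Im (- JMfun (-1) a b X))
           (\matrix_(a, b) Im (JMfun 1 a b X))
           (\matrix_(a, b) Re (- JMfun (-1) a b X)).
Proof.
rewrite Mnk_block /Jmx mulmx_block !mul0mx !mulNmx !mul1mx !add0r !addr0.
rewrite expr2 [LHS]mulmx_block.
(* The four block identities for a single summand c. *)
have pt (h h' w w' hb : C) : hb = h'^*%C ->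
  [/\ (Im h + Im w) * (Im h' + Im w') + (Re w - Re h) * (Re h' + Re w') =
      Re (- (h * h' - w * w'^*%C + 1 * (h * w' - hb * w))),
      (Im h + Im w) * (Re w' - Re h') + (Re w - Re h) * (Im h' - Im w') =
      Im (- (h * h' - w * w'^*%C + (-1) * (h * w' - hb * w))),
      (Re h + Re w) * (Im h' + Im w') + (Im h - Im w) * (Re h' + Re w') =
      Im (h * h' - w * w'^*%C + 1 * (h * w' - hb * w)) &
      (Re h + Re w) * (Re w' - Re h') + (Im h - Im w) * (Im h' - Im w') =
      Re (- (h * h' - w * w'^*%C + (-1) * (h * w' - hb * w)))].
  move=> ->; case: h h' w w' => [? ?] [? ?] [? ?] [? ?] /=.
  by split; ring.
have addE (A B : 'M[R]_k) a b : (A + B) a b = A a b + B a b by rewrite mxE.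
have oppE (A : 'M[R]_k) a b : (- A) a b = - A a b by rewrite mxE.
have mulE (A B : 'M[R]_k) a b : (A *m B) a b = \sum_c A a c * B c b.
  by rewrite mxE.
have funE (f : 'I_k -> 'I_k -> R) a b : (\matrix_(i, j) f i j) a b = f a b.
  by rewrite mxE.
have reE (A : 'M[C]_n) a b : compress (reM A) a b = Re (A (wd a) (wd b)).
  by rewrite /compress mxE /reM mxE.
have imE (A : 'M[C]_n) a b : compress (imM A) a b = Im (A (wd a) (wd b)).
  by rewrite /compress mxE /imM mxE.
congr block_mx; apply/matrixP => a b;
  rewrite addE !mulE funE /JMfun -?sumrN raddf_sum -big_split;
  apply: eq_bigr => c _; rewrite !(addE, oppE, reE, imE);
  have [e1 e2 e3 e4] := pt (H X (wd a) (wd c)) (H X (wd c) (wd b))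
    (W X (wd a) (wd c)) (W X (wd c) (wd b)) (H X (wd b) (wd c))
    (esym (hermf_conj _ _ _ _)).
- by apply: etrans e1; rewrite /=; ring.
- by apply: etrans e2; rewrite /=; ring.
- by apply: etrans e3; rewrite /=; ring.
- by apply: etrans e4; rewrite /=; ring.
Qed.

End CovarianceBlocks.

(** * The exact expectation *)

Section ExpectedSquare.
Set Implicit Arguments.
Unset Strict Implicit.
Variables (R : realType) (n : nat) (z : 'I_n -> R).
Local Notation C := R[i].

Definition mean_square (k : nat) : R :=
  hcoef_diag (zplus z) + k%:R * hcoef_off (zplus z)
  - (k%:R + 1) * wcoef (zminus z).

Variables (d : measure_display) (T : measurableType d) (P : probability T R).
Variable U : T -> 'M[C]_n.
Hypothesis haarU : haar_unitary P U.
Hypothesis n_gt1 : (1 < n)%N.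
Variables (k : nat) (hk : (k <= n)%N).
Local Notation H := (hermf (zplus z)).
Local Notation W := (symf (zminus z)).
Local Notation wd := (widen_ord hk).

Let sp_HH a b c e : starpoly (fun X => H X a b * H X c e).
Proof. by apply: sp_mul; exact: sp_hermf. Qed.

Let sp_WW a b c e : starpoly (fun X => W X a b * (W X c e)^*%C).
Proof.
by apply: sp_mul; [exact: sp_symf|apply: sp_conj; exact: sp_symf].
Qed.

Let sp_HW a b c e : starpoly (fun X => H X a b * W X c e).
Proof. by apply: sp_mul; [exact: sp_hermf|exact: sp_symf]. Qed.

Let sp_cross f a b c e a' b' c' e' :
  starpoly (fun X => f * (H X a b * W X c e - H X a' b' * W X c' e')).
Proof.
apply: sp_mul; first exact: sp_const.
by apply: sp_add; [exact: sp_HW|apply: sp_opp; exact: sp_HW].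
Qed.

Lemma starpoly_JMfun e a b : starpoly (JMfun z hk e a b).
Proof.
apply: sp_sum => c; apply: sp_add; last exact: sp_cross.
by apply: sp_add; [exact: sp_HH|apply: sp_opp; exact: sp_WW].
Qed.

(** Cross moments vanish, which removes e, and oddness settles a != b. For a = b each c contributes
    x - u and c = a contributes w - u more. *)
Lemma cexp_JMfun e a b :
  cexp P U (JMfun z hk e a b) = (((a == b)%:R * mean_square k)%:C)%C.
Proof.
rewrite /JMfun (cexp_sum haarU) => [|c]; last first.
  apply: sp_add; last exact: sp_cross.
  by apply: sp_add; [exact: sp_HH|apply: sp_opp; exact: sp_WW].
transitivity (\sum_(c < k) (hmoment P U (zplus z) (wd a) (wd c) (wd c) (wd b) -
                            wmoment P U (zminus z) (wd a) (wd c) (wd c) (wd b))).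
  apply: eq_bigr => c _; rewrite (cexpD haarU); last exact: sp_cross; last first.
    by apply: sp_add; [exact: sp_HH|apply: sp_opp; exact: sp_WW].
  rewrite (cexpB haarU) // (cexpZ haarU); last first.
    by apply: sp_add; [exact: sp_HW|apply: sp_opp; exact: sp_HW].
  by rewrite (cexpB haarU) // !(cross_moment0 haarU) subrr mulr0 addr0.
have [<-|ab] := eqVneq a b; last first.
  rewrite mul0r big1 // => c _.
  by rewrite (hmoment_odd haarU) // (wmoment_odd haarU) // subrr.
rewrite mul1r; have wdE (i j : 'I_k) : (wd i == wd j) = (i == j) by [].
under eq_bigr => c _ do
  rewrite (hmoment_val haarU n_gt1) (wmoment_val haarU n_gt1) -rmorphB /=.
rewrite -[LHS](rmorph_sum (real_complex R)) /=; congr (_%:C)%C.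
rewrite (eq_bigr (fun c => (hcoef_off (zplus z) - wcoef (zminus z)) +
    (a == c)%:R * (hcoef_diag (zplus z) - wcoef (zminus z)))); last first.
  by move=> c _; rewrite wdE; ring.
rewrite big_split /= sumr_const card_ord -mulr_suml.
rewrite (_ : \sum_(c < k) (a == c)%:R = 1 :> R); last first.
  rewrite (bigD1 a) //= eqxx big1 ?addr0 // => b'.
  by rewrite eq_sym => /negbTE ->.
by rewrite /mean_square -[_ *+ k]mulr_natl; ring.
Qed.

(** The expectation of [JMfun] is real, so the off-diagonal blocks, being imaginary parts, vanish;
    it does not depend on e, so the two diagonal blocks agree. *)
Lemma Emx_JM_sqr :
  Emx P (fun w => (Jmx R k *m Mnk hk z (U w)) ^+ 2) = (- mean_square k)%:M.
Proof.
have cN e a b : cexp P U (fun X => - JMfun z hk e a b X) =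
    ((- ((a == b)%:R * mean_square k))%:C)%C.
  rewrite (cexpN haarU) ?cexp_JMfun ?rmorphN //.
  exact: starpoly_JMfun.
have val (a b : 'I_k) : - ((a == b)%:R * mean_square k) =
    (- mean_square k)%:M a b.
  by rewrite mxE mulr_natl mulNrn.
rewrite scalar_mx_block; apply/matrixP => i j; rewrite [LHS]mxE.
case: (split_ordP i) => a ->; case: (split_ordP j) => b ->.
- rewrite block_mxEul -val.
  transitivity (complex.Re (cexp P U (fun X => - JMfun z hk 1 a b X))).
    by congr fine; apply: eq_integral => w _;
      rewrite JM_sqr_block block_mxEul mxE.
  by rewrite cN.
- rewrite block_mxEur [RHS]mxE.
  transitivity (complex.Im (cexp P U (fun X => - JMfun z hk (-1) a b X))).
    by congr fine; apply: eq_integral => w _;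
      rewrite JM_sqr_block block_mxEur mxE.
  by rewrite cN.
- rewrite block_mxEdl [RHS]mxE.
  transitivity (complex.Im (cexp P U (JMfun z hk 1 a b))).
    by congr fine; apply: eq_integral => w _;
      rewrite JM_sqr_block block_mxEdl mxE.
  by rewrite cexp_JMfun.
- rewrite block_mxEdr -val.
  transitivity (complex.Re (cexp P U (fun X => - JMfun z hk (-1) a b X))).
    by congr fine; apply: eq_integral => w _;
      rewrite JM_sqr_block block_mxEdr mxE.
  by rewrite cN.
Qed.

End ExpectedSquare.

(** * Distance of the exact value from the squared average energy *)

Section ErrorBound.
Set Implicit Arguments.
Unset Strict Implicit.
Variables (R : realType) (n : nat) (z : 'I_n -> R).

Lemma avg_energyE : (0 < n)%N -> \sum_j zplus z j = n%:R * avg_energy z.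
Proof.
move=> n0; have nz : (n%:R : R) != 0 by rewrite pnatr_eq0 -lt0n.
rewrite /avg_energy /zplus -mulr_suml; set S := \sum_(j < n) _.
by field.
Qed.

(** For N >= 2 one has N^2 <= 2 (N^2 - 1). *)
Lemma abs_div_pred_sqr (N x y : R) : 2 <= N -> `|x| <= y ->
  `|x / (N ^+ 2 - 1)| <= 2 * y / N ^+ 2.
Proof.
move=> N2 xy; have y0 : 0 <= y by exact: le_trans xy.
have D0 : 0 < N ^+ 2 - 1 by nra.
have N0 : 0 < N ^+ 2 by nra.
rewrite normrM normfV (gtr0_norm D0) ler_pdivrMr // mulrAC ler_pdivlMr //.
have yN : 0 <= y * (N ^+ 2 - 2) by rewrite mulr_ge0 //; nra.
by apply: le_trans (_ : y * N ^+ 2 <= _); [rewrite ler_pM2r|lra].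
Qed.

Lemma mean_square_error (k : nat) (B L : R) : (1 < n)%N -> (0 < k)%N ->
  (forall j, 1 <= z j <= B) -> avg_energy z <= L ->
  `|avg_energy z ^+ 2 - mean_square z k| <=
  k%:R / n%:R * B * (6 * L + 4 * L ^+ 2).
Proof.
move=> n1 k0 hz lamL; set lam := avg_energy z in lamL *.
have n0 : (0 < n)%N by exact: ltnW.
have T1 := avg_energyE n0; rewrite -/lam in T1.
rewrite /mean_square /hcoef_diag /hcoef_off /wcoef T1.
set T2 := \sum_j zplus z j ^+ 2; set T2' := \sum_j zminus z j ^+ 2.
have N2 : 2 <= (n%:R : R) by rewrite ler_nat.
have K1 : 1 <= (k%:R : R) by rewrite ler1n.
have B1 : 1 <= B by have /andP[] := hz (Ordinal n0); exact: le_trans.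
have zi j : 0 < (z j)^-1 <= 1.
  have /andP[z1 _] := hz j; have z0 : 0 < z j by exact: lt_le_trans z1.
  by rewrite invr_gt0 z0 invf_le1.
have zp0 j : 0 <= zplus z j.
  by have /andP[? _] := zi j; have /andP[? _] := hz j; rewrite /zplus; lra.
have T2_ge0 : 0 <= T2 by apply: sumr_ge0 => j _; exact: sqr_ge0.
have T2'_ge0 : 0 <= T2' by apply: sumr_ge0 => j _; exact: sqr_ge0.
have T2'_le : T2' <= T2.
  apply: ler_sum => j _; have /andP[? ?] := zi j; have /andP[? _] := hz j.
  by rewrite /zplus /zminus; nra.
(* As z >= 1, (z + 1/z)/2 <= z <= B: one factor of each square is bounded by B, and the other sums
   to n lam. *)
have T2_le : T2 <= B * (n%:R * lam).
  rewrite -T1 mulr_sumr; apply: ler_sum => j _; rewrite expr2 ler_wpM2r //.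
  have /andP[? ?] := zi j; have /andP[? ?] := hz j.
  by rewrite /zplus; lra.
have lam0 : 0 <= lam.
  have : 0 <= n%:R * lam by rewrite -T1; apply: sumr_ge0.
  by rewrite pmulr_rge0 //; lra.
move: (n%:R : R) (k%:R : R) N2 K1 T2_le => N K N2 K1 T2_le {T1}.
have N0 : N != 0 by rewrite gt_eqF //; lra.
have Npos : 0 < N by lra.
have D0 : N ^+ 2 - 1 != 0 by rewrite gt_eqF //; nra.
(* Dominates |T2 / N - lam^2|, which governs the error in w and, multiplied by N, the size of x. *)
pose r := B * lam + lam ^+ 2.
have r0 : 0 <= r by rewrite /r; nra.
have T2N : T2 / N <= B * lam by rewrite ler_pdivrMr //; nra.
have T2N0 : 0 <= T2 / N by rewrite divr_ge0 // ltW.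
have e1 : `|(T2 / N - lam ^+ 2) / (N ^+ 2 - 1)| <= 2 * r / N ^+ 2.
  by apply: abs_div_pred_sqr => //; rewrite ler_norml /r; apply/andP; split; nra.
have e2 : `|(T2 - (N * lam) ^+ 2 / N) / (N ^+ 2 - 1)| <= 2 * (N * r) / N ^+ 2.
  apply: abs_div_pred_sqr => //.
  have -> : (N * lam) ^+ 2 / N = N * lam ^+ 2 by field.
  by rewrite ler_norml /r; apply/andP; split; nra.
have e3 : 0 <= T2' / (N ^+ 2 + N) <= B * lam / N.
  rewrite divr_ge0 //=; last by nra.
  rewrite ler_pdivrMr; last by nra.
  have -> : B * lam / N * (N ^+ 2 + N) = B * lam * (N + 1) by field.
  by nra.
move: e3; set w := T2' / _ => /andP[w0 w1].
set x1 := _ / _ in e1; set x2 := (_ / (N ^+ 2 - 1)) in e2.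
(* The leading term w differs from lam^2 by exactly x1, which leaves three small terms. *)
have -> : lam ^+ 2 - (((N * lam) ^+ 2 - T2 / N) / (N ^+ 2 - 1) + K * x2 -
   (K + 1) * w) = x1 - K * x2 + (K + 1) * w by rewrite /x1; field; rewrite N0 D0.
(* Absorbed into the common order K / N because K N >= 1. *)
have f1 : 2 * r / N ^+ 2 <= 2 * (K / N) * r.
  rewrite ler_pdivrMr; last by nra.
  have -> : 2 * (K / N) * r * N ^+ 2 = 2 * r * (K * N) by field.
  by rewrite -[leLHS]mulr1 ler_wpM2l; nra.
have f2 : K * (2 * (N * r) / N ^+ 2) = 2 * (K / N) * r by field.
have f3 : (K + 1) * w <= 2 * (K / N) * (B * lam).
  apply: le_trans (_ : (K + 1) * (B * lam / N) <= _).
    by rewrite ler_wpM2l //; lra.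
  have -> : 2 * (K / N) * (B * lam) = (2 * K) * (B * lam / N) by field.
  by rewrite ler_wpM2r //; [rewrite divr_ge0 //; nra|lra].
have g : `|x1 - K * x2 + (K + 1) * w| <=
    2 * (K / N) * r + 2 * (K / N) * r + 2 * (K / N) * (B * lam).
  apply: (le_trans (ler_normD _ _)); apply: lerD; last first.
    by rewrite ger0_norm // mulr_ge0 //; lra.
  apply: (le_trans (ler_normB _ _)); apply: lerD; first exact: le_trans e1 f1.
  rewrite normrM -f2 ger0_norm; last by lra.
  by rewrite ler_wpM2l //; lra.
apply: (le_trans g).
have KN : 0 <= K / N by rewrite divr_ge0 //; lra.
(* Here B >= 1 gives lam^2 <= B L^2; then 4 r + 2 B lam <= B (6 L + 4 L^2), the announced
   constant. *)
have rB : r <= B * (L + L ^+ 2) by rewrite /r; nra.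
have lB : B * lam <= B * L by rewrite ler_wpM2l //; lra.
have t : 0 <= K / N * (B * (6 * L + 4 * L ^+ 2) - (4 * r + 2 * (B * lam))).
  by rewrite mulr_ge0 //; lra.
by move: t; set q := K / N => t; lra.
Qed.

End ErrorBound.

(** * The asymptotic statement *)

Theorem theorem1 (R : realType) (z : forall n : nat, 'I_n -> R) (zeta kappa : R)
  (k : nat -> nat)
  (hz1 : forall n (j : 'I_n), 1 <= z n j)
  (hzeta : 0 <= zeta < 1)
  (hsq : exists C : R, 0 < C /\ exists N : nat, forall n, (N <= n)%N ->
           opnorm_diag (z n) <= C * n%:R `^ zeta)
  (hlam : exists L : R, forall n, (0 < n)%N -> avg_energy (z n) <= L)
  (hk1 : forall n, (0 < n)%N -> (0 < k n)%N)
  (hk2 : forall n, (k n <= n)%N)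
  (hkappa : 0 <= kappa < 1)
  (hkb : exists K : R, 0 < K /\ exists N : nat, forall n, (N <= n)%N ->
           (k n)%:R <= K * n%:R `^ kappa) :
  exists C : R, exists N : nat, forall n, (N <= n)%N ->
    exists e : R, `|e| <= C * n%:R `^ (kappa + zeta - 1) /\
    forall (d : measure_display) (T : measurableType d) (P : probability T R)
           (U : T -> 'M[R[i]]_n),
      haar_unitary P U ->
      Emx P (fun w => (Jmx R (k n) *m Mnk (hk2 n) (z n) (U w)) ^+ 2)
        = (- avg_energy (z n) ^+ 2 + e)%:M.
Proof.
have [C [C0 [N1 hC]]] := hsq; have [L hL] := hlam; have [K [K0 [N2 hK]]] := hkb.
(* The constant of [mean_square_error] with B = C n^zeta and k <= K n^kappa. The threshold 2 keeps
   n^2 - 1 nonzero and provides two distinct indices. *)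
exists (K * C * (6 * L + 4 * L ^+ 2)), (maxn 2 (maxn N1 N2)) => n.
rewrite !geq_max => /and3P[n1 nN1 nN2].
(* The exact deviation, a number fixed before any probability space is chosen. *)
exists (avg_energy (z n) ^+ 2 - mean_square (z n) (k n)); split; last first.
  move=> d T P U haarU; rewrite (Emx_JM_sqr (z n) haarU n1); congr _%:M.
  by rewrite addrA addNr add0r.
have n0 : (0 < n)%N by exact: ltnW.
have hz j : 1 <= z n j <= C * n%:R `^ zeta.
  rewrite hz1 /=; apply: le_trans (hC n nN1).
  apply: le_trans (ler_norm _) _.
  exact: (le_bigmax _ (fun i => `|z n i|)).
apply: le_trans (mean_square_error n1 (hk1 n n0) hz (hL n n0)) _.
have npos : 0 < n%:R :> R by rewrite ltr0n.
have nneq : n%:R != 0 :> R by rewrite gt_eqF.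
rewrite powRD ?nneq ?implybT // powRN powRr1 ?(ltW npos) // powRD ?nneq ?implybT //.
(* The average energy is nonnegative, hence so is 6 L + 4 L^2, and the bounds on the other factors
   may be multiplied by it. *)
have L0 : 0 <= L.
  apply: le_trans (hL n n0); rewrite /avg_energy mulr_ge0 //.
    by rewrite invr_ge0 mulr_ge0 // ltW.
  apply: sumr_ge0 => j _; have z0 := le_trans ler01 (hz1 n j).
  by rewrite addr_ge0 // invr_ge0.
set A := n%:R `^ kappa; set B := n%:R `^ zeta.
rewrite (_ : K * C * _ * _ =
  K * A / n%:R * (C * B) * (6 * L + 4 * L ^+ 2)); last by field.
rewrite ler_wpM2r ?addr_ge0 ?mulr_ge0 ?sqr_ge0 //.
rewrite ler_wpM2r ?mulr_ge0 ?powR_ge0 ?(ltW C0) //.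
by rewrite ler_wpM2r ?invr_ge0 ?(ltW npos) ?hK.
Qed.
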